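(* Let $G=\mathbb{Z}/4\mathbb{Z}$ with generator $\zeta$ (written multiplicatively), and let $Q$ be a quiver with an action of $G$ by quiver isomorphisms, with orbits $O_1,\dots,O_m$, chosen representatives $x_i\in O_i$, and folded exchange matrix $B=B^Q_G(x_1,\dots,x_m)=(b_{ij})$. Suppose $b_{kk}=\zeta-\zeta^{-1}$ for some index $k$. Let $Q'$ be the quiver obtained from $Q$ by the generalized mutation at the orbit $O_k$. Then $Q'$ is again invariant under the action of $G$, and its folded exchange matrix $B^{Q'}_G(x_1,\dots,x_m)=(b'_{ij})$ is given as follows. For $i=k$ or $j=k$, $$\begin{aligned}b'_{ij}=b_{ij}&-\big[b_{ij}\zeta+[b_{ij}]_-\big]_-\\&-\Big[-b_{ij}\zeta-[b_{ij}]_-+\big[b_{ij}\zeta^2+[b_{ij}\zeta+[b_{ij}]_-]_-\big]_-+\big[b_{ij}\zeta^3+[b_{ij}]_++[b_{ij}\zeta+[b_{ij}]_-]_+\big]_+\Big]_+ ,\end{aligned}$$ and otherwise $$\begin{aligned} b'_{ij}=b_{ij}+\tfrac14\Big[&\,b_{ik}\circ b_{kj}-b'_{ik}\circ b'_{kj}\\ &+(b_{ik}\zeta^{-1}+[b_{ik}]_+)\circ(b_{kj}\zeta+[b_{kj}]_-)\\ &+\big(b_{ik}\zeta^2+[b_{ik}\zeta^{-1}+[b_{ik}]_+]_+\big)\circ\big(b_{kj}\zeta^2+[b_{kj}\zeta+[b_{kj}]_-]_-\big)\\ &+\big(b_{ik}\zeta+[b_{ik}]_-+[b_{ik}\zeta^{-1}+[b_{ik}]_+]_-\big)\circ\big(b_{kj}\zeta^{-1}+[b_{kj}]_++[b_{kj}\zeta+[b_{kj}]_-]_+\big)\\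 &+\Big(-b_{ik}\zeta^{-1}-[b_{ik}]_++\big[b_{ik}\zeta^2+[b_{ik}\zeta^{-1}+[b_{ik}]_+]_+\big]_++\big[b_{ik}\zeta+[b_{ik}]_-+[b_{ik}\zeta^{-1}+[b_{ik}]_+]_-\big]_-\Big)\\ &\quad\circ\Big(-b_{kj}\zeta-[b_{kj}]_-+\big[b_{kj}\zeta^2+[b_{kj}\zeta+[b_{kj}]_-]_-\big]_-+\big[b_{kj}\zeta^{-1}+[b_{kj}]_++[b_{kj}\zeta+[b_{kj}]_-]_+\big]_+\Big)\Big]. \end{aligned}$$
   Context: A quiver is a finite directed graph (multiple arrows allowed) without loops and without oriented 2-cycles. Its exchange matrix $(\beta_{uv})$ is the skew-symmetric integer matrix with $\beta_{uv}=l$ if there are $l$ arrows from $u$ to $v$, $-l$ if there are $l$ arrows from $v$ to $u$, and $0$ otherwise. $G$ acts by quiver isomorphisms if $\beta_{g\cdot u,\,g\cdot v}=\beta_{uv}$ for all $g\in G$ and all nodes $u,v$. Mutation $\mu_v$ at a node $v$: for every pair of arrows $u\to v$, $v\to w$ add an arrow $u\to w$; remove oriented 2-cycles; reverse all arrows incident to $v$. Folded exchange matrix: with $H_j=\mathrm{Stab}_G(x_j)$, $B^Q_G(x_1,\dots,x_m)=(b_{ij})$ is the $m\times m$ matrix over $\mathbb{Z}[G][|G|^{-1}]$ (the group ring of $G$ over $\mathbb{Z}[1/|G|]$) with $b_{ij}=\frac{1}{|H_j|}\sum_{g\in G}\beta_{x_i,\,g\cdot x_j}\,g$. A quiver $Q$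 with $G$-action whose folded exchange matrix is $B$ is called a symmetric unfolding of $B$. For $a=\sum_g a_g g$ put $[a]_+=\sum_g\max(a_g,0)\,g$ and $[a]_-=\sum_g\min(a_g,0)\,g$, and $a\circ b=[a]_+[b]_+-[a]_-[b]_-$. Generalized mutation at $O_k$: the condition $b_{kk}=\zeta-\zeta^{-1}$ means that the nodes $k_1=x_k$, $k_2=\zeta x_k$, $k_3=\zeta^2x_k$, $k_4=\zeta^3x_k$ of $O_k$ form an oriented 4-cycle $k_1\to k_2\to k_3\to k_4\to k_1$ of single arrows (with no other arrows among them). The generalized mutation at $O_k$ mutates $Q$ successively at $k_1,k_2,k_3,k_4,k_2,k_1$ (the two middle mutations, at $k_3$ and $k_4$, commute) and then relabels the nodes by exchanging $k_3$ and $k_4$ (all other nodes keep their labels). The ''mutation of $B$ at $k$'' is by definition obtained by performing this on a symmetric unfolding and refolding. *)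

(* Defs.v *)
From HB Require Import structures.
From mathcomp Require Import all_boot all_order all_algebra all_fingroup.
Set Implicit Arguments.
Unset Strict Implicit.
Unset Printing Implicit Defensive.
Import Order.TTheory GRing.Theory Num.Theory.
Local Open Scope ring_scope.

(* The subring Z[1/n] of the rationals: a fraction in lowest terms belongs to
   it iff every prime factor of its denominator divides n. *)
Definition in_Zinv (n : nat) : {pred rat} :=
  fun q => \pi(n).-nat `|denq q|%N.

Lemma in_ZinvP n (q : rat) :
  reflect (exists2 N : nat, \pi(n).-nat N & q * N%:R \is a Num.int)
          (q \in in_Zinv n).
Proof.
apply: (iffP idP) => [qn|[N Nn /intrP[c qN]]].
  exists `|denq q|%N => //.
  by rewrite natr_absz gtr0_norm ?denq_gt0 // -numqE intr_int.
have N0 : N%:R != 0 :> rat by rewrite pnatr_eq0 -lt0n; case/andP: Nn.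
apply: pnat_dvd Nn.
have : numq q * N%:Z = c * denq q.
  apply: (@intr_inj rat); rewrite !rmorphM /= -qN -{2}(divq_num_den q).
  by rewrite mulrAC divfK ?intr_eq0 ?denq_neq0.
move/(congr1 absz); rewrite !abszM => e.
have : (`|denq q| %| `|numq q| * N)%N by rewrite e dvdn_mull.
by rewrite Gauss_dvdr // coprime_sym; exact: coprime_num_den.
Qed.

Fact in_Zinv_subring n : subring_closed (in_Zinv n).
Proof.
split=> [|x y|x y]; first by apply/in_ZinvP; exists 1%N; rewrite ?mulr1.
- move=> /in_ZinvP[M Mn xM] /in_ZinvP[N Nn yN]; apply/in_ZinvP.
  exists (M * N)%N; first by rewrite pnatM Mn.
  rewrite natrM mulrBl mulrA [M%:R * _]mulrC [y * _]mulrA.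
  by rewrite rpredB // rpredM // natr_int.
move=> /in_ZinvP[M Mn xM] /in_ZinvP[N Nn yN]; apply/in_ZinvP.
exists (M * N)%N; first by rewrite pnatM Mn.
by rewrite natrM mulrACA rpredM.
Qed.

HB.instance Definition _ n :=
  GRing.isSubringClosed.Build rat (in_Zinv n) (in_Zinv_subring n).

Record Zinv (n : nat) :=
  MkZinv { Zinv_val : rat; Zinv_valP : Zinv_val \in in_Zinv n }.

HB.instance Definition _ n := [isSub for @Zinv_val n].
HB.instance Definition _ n := [Choice of Zinv n by <:].
HB.instance Definition _ n := [SubChoice_isSubComNzRing of Zinv n by <:].

Section ZinvUnit.
Variable n : nat.
Implicit Types x y : Zinv n.

Definition Zinv_unit : {pred Zinv n} :=
  fun x => (val x != 0) && ((val x)^-1 \in in_Zinv n).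
Definition Zinv_inv x : Zinv n := insubd x (val x)^-1.

Fact Zinv_mulVx : {in Zinv_unit, left_inverse 1 Zinv_inv *%R}.
Proof.
move=> x /andP[x0 xV]; apply: val_inj.
by rewrite rmorphM rmorph1 /= /Zinv_inv [Zinv_val _]insubdK ?mulVf.
Qed.

Fact Zinv_unitPl x y : y * x = 1 -> Zinv_unit x.
Proof.
move=> /(congr1 val); rewrite rmorphM rmorph1 /= => yx1.
have x0 : Zinv_val x != 0.
  by apply/eqP => x0; move/eqP: yx1; rewrite x0 mulr0 eq_sym oner_eq0.
apply/andP; split=> //=.
by rewrite -[_^-1]mul1r -yx1 mulfK // Zinv_valP.
Qed.

Fact Zinv_inv_out : {in [predC Zinv_unit], Zinv_inv =1 id}.
Proof.
move=> x; rewrite inE unfold_in negb_and negbK => /orP[/eqP x0|xV].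
  by apply: val_inj; rewrite /Zinv_inv val_insubd x0 invr0.
by apply: val_inj; rewrite /Zinv_inv val_insubd (negbTE xV).
Qed.

End ZinvUnit.

HB.instance Definition _ n := GRing.ComNzRing_hasMulInverse.Build (Zinv n)
  (@Zinv_mulVx n) (@Zinv_unitPl n) (@Zinv_inv_out n).

Fact Zinv_idomain n : GRing.integral_domain_axiom (Zinv n).
Proof.
move=> x y /(congr1 val); rewrite rmorphM rmorph0 => /eqP.
by rewrite mulf_eq0 => /orP[] /eqP e; apply/orP; [left|right];
  apply/eqP/val_inj; rewrite e rmorph0.
Qed.
HB.instance Definition _ n :=
  GRing.ComUnitRing_isIntegral.Build (Zinv n) (@Zinv_idomain n).

Section ZinvOrder.
Variable n : nat.
Implicit Types x y : Zinv n.

Definition Zinv_le x y := val x <= val y.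
Definition Zinv_lt x y := val x < val y.
Definition Zinv_norm x := if 0 <= val x then x else - x.

Fact Zinv_le0D x y : Zinv_le 0 x -> Zinv_le 0 y -> Zinv_le 0 (x + y).
Proof. by rewrite /Zinv_le !(rmorph0, rmorphD) /=; apply: addr_ge0. Qed.

Fact Zinv_le0M x y : Zinv_le 0 x -> Zinv_le 0 y -> Zinv_le 0 (x * y).
Proof. by rewrite /Zinv_le !(rmorph0, rmorphM) /=; apply: mulr_ge0. Qed.

Fact Zinv_le0_anti x : Zinv_le 0 x -> Zinv_le x 0 -> x = 0.
Proof.
by rewrite /Zinv_le => x0 x1; apply/val_inj/le_anti; rewrite x1 x0.
Qed.

Fact Zinv_sub_ge0 x y : Zinv_le 0 (y - x) = Zinv_le x y.
Proof. by rewrite /Zinv_le rmorph0 rmorphB subr_ge0. Qed.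

Fact Zinv_le0_total x : Zinv_le 0 x || Zinv_le x 0.
Proof. exact: le_total. Qed.

Fact Zinv_normN x : Zinv_norm (- x) = Zinv_norm x.
Proof.
rewrite /Zinv_norm rmorphN oppr_ge0 opprK.
have [lx|lx|e] := ltgtP (val x) 0 => //.
by apply: val_inj; rewrite rmorphN e /= e oppr0.
Qed.

Fact Zinv_ge0_norm x : Zinv_le 0 x -> Zinv_norm x = x.
Proof. by rewrite /Zinv_le /Zinv_norm rmorph0 => ->. Qed.

Fact Zinv_lt_def x y : Zinv_lt x y = (y != x) && Zinv_le x y.
Proof. by rewrite /Zinv_lt /Zinv_le lt_def (inj_eq val_inj). Qed.

End ZinvOrder.

HB.instance Definition _ n := Num.IntegralDomain_isLeReal.Build (Zinv n)
  (@Zinv_le0D n) (@Zinv_le0M n) (@Zinv_le0_anti n) (@Zinv_sub_ge0 n)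
  (@Zinv_le0_total n) (@Zinv_normN n) (@Zinv_ge0_norm n) (@Zinv_lt_def n).

(* Hence the inverses d%:R^-1 below are genuine ones for d dividing #|gT|. *)
Lemma Zinv_natr_unit n d :
  (0 < n)%N -> (d %| n)%N -> (d%:R : Zinv n) \is a GRing.unit.
Proof.
move=> n0 dn; have d0 : (0 < d)%N by apply: dvdn_gt0 dn.
rewrite unfold_in /= /Zinv_unit rmorph_nat pnatr_eq0 -lt0n d0 /=.
apply/in_ZinvP; exists d; first by apply: pnat_dvd dn (pnat_pi n0).
by rewrite mulVf ?pnatr_eq0 -?lt0n.
Qed.

(* The group ring of a finite group over R.  It is an alias of
   {ffun gT -> R}, so that its product is the convolution below and not the
   pointwise product of finite functions. *)
Definition group_ring (R : nzRingType) (gT : finGroupType) : Type :=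
  {ffun gT -> R}.

Section GroupRing.
Variables (R : comNzRingType) (gT : finGroupType).
Local Notation RG := (group_ring R gT).
Implicit Types a b c : RG.

HB.instance Definition _ := GRing.Zmodule.on RG.

Definition gr_elt (g : gT) : RG := [ffun h => (h == g)%:R].

Definition gr_mul a b : RG := [ffun g => \sum_h a h * b (h^-1 * g)%g].

Definition gr_scale (r : R) a : RG := [ffun g => r * a g].

Fact gr_mulA : associative gr_mul.
Proof.
move=> a b c; apply/ffunP=> g; rewrite !ffunE.
under eq_bigr do rewrite ffunE mulr_sumr.
under [RHS]eq_bigr do rewrite ffunE mulr_suml.
rewrite [RHS]exchange_big /=; apply: eq_bigr => h _.
rewrite [RHS](reindex_inj (mulgI h)) /=; apply: eq_bigr => k _.
by rewrite mulKg invMg mulgA mulrA.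
Qed.

Fact gr_mul1r : left_id (gr_elt 1) gr_mul.
Proof.
move=> a; apply/ffunP=> g; rewrite ffunE (bigD1 1%g) //= ffunE eqxx mul1r.
rewrite invg1 mul1g big1 ?addr0 // => h /negbTE h1.
by rewrite ffunE h1 mul0r.
Qed.

Fact gr_mulr1 : right_id (gr_elt 1) gr_mul.
Proof.
move=> a; apply/ffunP=> g; rewrite ffunE (bigD1 g) //= ffunE mulVg eqxx mulr1.
rewrite big1 ?addr0 // => h hg.
by rewrite ffunE -eq_invg_mul invgK (negbTE hg) mulr0.
Qed.

Fact gr_mulDl : left_distributive gr_mul +%R.
Proof.
move=> a b c; apply/ffunP=> g; rewrite !ffunE -big_split /=.
by apply: eq_bigr => h _; rewrite ffunE mulrDl.
Qed.

Fact gr_mulDr : right_distributive gr_mul +%R.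
Proof.
move=> a b c; apply/ffunP=> g; rewrite !ffunE -big_split /=.
by apply: eq_bigr => h _; rewrite ffunE mulrDr.
Qed.

Fact gr_oner_neq0 : gr_elt 1 != 0.
Proof.
by apply/eqP=> /ffunP/(_ 1%g)/eqP; rewrite !ffunE eqxx oner_eq0.
Qed.

HB.instance Definition _ := GRing.Zmodule_isNzRing.Build RG
  gr_mulA gr_mul1r gr_mulr1 gr_mulDl gr_mulDr gr_oner_neq0.

Fact gr_scalerA r s a : gr_scale r (gr_scale s a) = gr_scale (r * s) a.
Proof. by apply/ffunP=> g; rewrite !ffunE mulrA. Qed.

Fact gr_scale1r : left_id 1 gr_scale.
Proof. by move=> a; apply/ffunP=> g; rewrite !ffunE mul1r. Qed.

Fact gr_scalerDr : right_distributive gr_scale +%R.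
Proof. by move=> r a b; apply/ffunP=> g; rewrite !ffunE mulrDr. Qed.

Fact gr_scalerDl a : {morph gr_scale^~ a : r s / r + s}.
Proof. by move=> r s; apply/ffunP=> g; rewrite !ffunE mulrDl. Qed.

HB.instance Definition _ := GRing.Zmodule_isLmodule.Build R RG
  gr_scalerA gr_scale1r gr_scalerDr gr_scalerDl.

Fact gr_scalerAl r a b : r *: (a * b) = (r *: a) * b.
Proof.
apply/ffunP=> g; rewrite !ffunE mulr_sumr.
by apply: eq_bigr => h _; rewrite ffunE mulrA.
Qed.
HB.instance Definition _ := GRing.Lmodule_isLalgebra.Build R RG gr_scalerAl.

Fact gr_scalerAr r a b : r *: (a * b) = a * (r *: b).
Proof.
apply/ffunP=> g; rewrite !ffunE mulr_sumr.
by apply: eq_bigr => h _; rewrite ffunE mulrCA.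
Qed.
HB.instance Definition _ := GRing.Lalgebra_isAlgebra.Build R RG gr_scalerAr.

End GroupRing.

Arguments gr_elt {R gT} g%_g.

Section GroupRingParts.
Variables (R : realDomainType) (gT : finGroupType).
Implicit Types a b : group_ring R gT.

Definition gr_pos a : group_ring R gT := [ffun g => Num.max (a g) 0].
Definition gr_neg a : group_ring R gT := [ffun g => Num.min (a g) 0].
Definition gr_circ a b : group_ring R gT :=
  gr_pos a * gr_pos b - gr_neg a * gr_neg b.

End GroupRingParts.

Notation "[ a ]_+" := (gr_pos a) (at level 0, a at level 99) : ring_scope.
Notation "[ a ]_-" := (gr_neg a) (at level 0, a at level 99) : ring_scope.
Notation "a ∘ b" := (gr_circ a b) (at level 40, left associativity) : ring_scope.

(* [arrows Q u v] is the number of arrows from u to v. *)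
Record quiver (V : finType) := Quiver {
  arrows :> V -> V -> nat;
  quiver_loopless : forall u, arrows u u = 0%N;
  quiver_no2cycle : forall u v, arrows u v = 0%N \/ arrows v u = 0%N }.

Definition exchange (V : finType) (Q : quiver V) (u v : V) : int :=
  (Q u v)%:Z - (Q v u)%:Z.

Section Mutation.
Variables (V : finType) (Q : quiver V) (v : V).

Definition add_paths (u w : V) : nat := (Q u w + Q u v * Q v w)%N.

(* Truncated subtraction: this removes a maximal set of disjoint oriented
   2-cycles between u and w. *)
Definition cancel_2cycles (a : V -> V -> nat) (u w : V) : nat :=
  (a u w - a w u)%N.

Definition reverse_at (a : V -> V -> nat) (u w : V) : nat :=
  if (u == v) || (w == v) then a w u else a u w.

Definition mutation_arrows : V -> V -> nat :=
  reverse_at (cancel_2cycles add_paths).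

Fact mutation_loopless u : mutation_arrows u u = 0%N.
Proof.
by rewrite /mutation_arrows /reverse_at /cancel_2cycles subnn if_same.
Qed.

Fact mutation_no2cycle u w :
  mutation_arrows u w = 0%N \/ mutation_arrows w u = 0%N.
Proof.
rewrite /mutation_arrows /reverse_at /cancel_2cycles orbC.
by case: ifP => _; case/orP: (leq_total (add_paths u w) (add_paths w u));
  rewrite -subn_eq0 => /eqP; tauto.
Qed.

Definition mutation : quiver V :=
  Quiver mutation_loopless mutation_no2cycle.

End Mutation.

Section Relabel.
Variables (V : finType) (s : {perm V}) (Q : quiver V).

(* The node u of Q becomes the node s u. *)
Definition relabel_arrows (u w : V) : nat := Q ((s^-1)%g u) ((s^-1)%g w).

Fact relabel_loopless u : relabel_arrows u u = 0%N.
Proof. exact: quiver_loopless. Qed.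

Fact relabel_no2cycle u w :
  relabel_arrows u w = 0%N \/ relabel_arrows w u = 0%N.
Proof. exact: quiver_no2cycle. Qed.

Definition relabel : quiver V := Quiver relabel_loopless relabel_no2cycle.

End Relabel.

Section SymmetricQuiver.
Variables (gT : finGroupType) (V : finType) (to : {action gT &-> V}).

(* MathComp actions are right actions; [lact g u] is the left action g . u,
   with the same orbits and stabilisers. *)
Definition lact (g : gT) (u : V) : V := to u (g^-1)%g.

Definition quiver_invariant (Q : quiver V) : Prop :=
  forall (g : gT) (u v : V),
    exchange Q (lact g u) (lact g v) = exchange Q u v.

Definition folded_matrix (Q : quiver V) (m : nat) (x : 'I_m -> V) :
    'M[group_ring (Zinv #|gT|) gT]_m :=
  \matrix_(i < m, j < m)
    ((#|('C[x j | to])%g|%:R : Zinv #|gT|)^-1 *: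
      \sum_(g : gT) (exchange Q (x i) (lact g (x j)))%:~R *: gr_elt g).

(* The mutations are performed from left to right, starting with k1. *)
Definition generalized_mutation (z : gT) (Q : quiver V) (k1 : V) : quiver V :=
  let k2 := lact z k1 in
  let k3 := lact (z ^+ 2)%g k1 in
  let k4 := lact (z ^+ 3)%g k1 in
  relabel (tperm k3 k4)
    (foldl (@mutation V) Q [:: k1; k2; k3; k4; k2; k1]).

End SymmetricQuiver.

Arguments lact {gT V} to g%_g u.

(* Main.v *)
(* Let y = (y1, y2, y3, y4) collect the exchange entries between the four nodes
   of O_k and a node off O_k.  Along the six mutations the entry at the node
   being mutated is a piecewise linear function of y, pivot1 = y1, ..., pivot6;
   the entries of k1, ..., k4 end up as minus pivot6 of the cyclic rotations of
   y, and the entry between two nodes u, w off O_k grows by the sum over the six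
   pivots p of [p(u)]_+ [p(w)]_- - [p(u)]_- [p(w)]_+.  This sum is invariant
   under simultaneous rotation of both vectors, because the positive parts of
   the pivots of the rotated vector are linear combinations of those of the
   original one; this gives the invariance of Q'.  Its folded matrix then comes
   from reading group ring elements as functions on G: multiplication by zeta
   rotates y, and the product of two entries sums the local contributions over
   G, all of which are equal by invariance. *)
Require Import Defs.
From HB Require Import structures.
From mathcomp Require Import all_boot all_order all_algebra all_fingroup.
From mathcomp Require Import cyclic zify ring.
Set Implicit Arguments.
Unset Strict Implicit.
Unset Printing Implicit Defensive.
Import Order.TTheory GRing.Theory Num.Theory.
Local Open Scope ring_scope.

(** * Pivots *)

Section Pivots.
Variable R : realDomainType.
Implicit Types a b c d : R.

(** Scalar versions of the group ring operations. They are kept general because they apply both to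
    integer exchange entries and to coefficients of group ring elements. *)
Definition pos a := Num.max a 0.
Definition neg a := Num.min a 0.
Definition circ a b := pos a * pos b - neg a * neg b.

(** Pivot n is the entry at the node mutated in step n, for initial entries [a], [b], [c], [d] at
    k1, ..., k4. In [pivot4] there is no [c] because k3 and k4 are not joined when k3 is mutated. *)
Definition pivot2 a b := b + neg a.
Definition pivot3 a b c := c + neg (pivot2 a b).
Definition pivot4 a b d := d + pos a + pos (pivot2 a b).
Definition pivot5 a b c d :=
  - pivot2 a b + neg (pivot3 a b c) + pos (pivot4 a b d).
Definition pivot6 a b c d := - a + neg (pivot2 a b) + pos (pivot5 a b c d).

Lemma negE a : neg a = a - pos a.
Proof. by apply/eqP; rewrite eq_sym subr_eq addrC addr_max_min addr0. Qed.

Lemma posN a : pos (- a) = - neg a.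
Proof. by rewrite /pos /neg -{1}oppr0 -oppr_min. Qed.

Lemma negN a : neg (- a) = - pos a.
Proof. by rewrite -[a in RHS]opprK posN opprK. Qed.

Lemma circ_neg a b : circ (- a) b = pos a * neg b - neg a * pos b.
Proof. rewrite /circ posN negN; ring. Qed.

Lemma circNN a b : circ (- a) (- b) = - circ a b.
Proof. rewrite /circ !posN !negN; ring. Qed.

End Pivots.

(** For a skew matrix, mutation at v adds [wedge (M v u) (M v w)] to the entry between two other
    nodes u and w, so both arguments are read in the row of v. *)
Definition wedge (a b : int) := circ (- a) b.

Definition pivot_sum (a b c d a' b' c' d' : int) :=
  wedge a a' + wedge (pivot2 a b) (pivot2 a' b')
  + wedge (pivot3 a b c) (pivot3 a' b' c')
  + wedge (pivot4 a b d) (pivot4 a' b' d')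
  + wedge (pivot5 a b c d) (pivot5 a' b' c' d')
  + wedge (pivot6 a b c d) (pivot6 a' b' c' d').

Local Notation pos_cases x :=
  ((0 <= x /\ pos x = x) \/ (x <= 0 /\ pos x = 0)).

Lemma pos_spec (x : int) : pos_cases x.
Proof.
by rewrite /pos; case: (leP x 0); [right|left]; split=> //; apply: ltW.
Qed.

(** A form suited to [lia]: [neg] is eliminated and every positive part becomes a sign alternative,
    so piecewise linear identities reduce to linear arithmetic. *)
Variant pivot_spec (a b c d : int) : Prop := PivotSpec of
  pos_cases a
  & pivot2 a b = b + a - pos a
  & pos_cases (pivot2 a b)
  & pivot3 a b c = c + pivot2 a b - pos (pivot2 a b)
  & pos_cases (pivot3 a b c)
  & pivot4 a b d = d + pos a + pos (pivot2 a b)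
  & pos_cases (pivot4 a b d)
  & pivot5 a b c d = - pivot2 a b + pivot3 a b c - pos (pivot3 a b c)
                     + pos (pivot4 a b d)
  & pos_cases (pivot5 a b c d)
  & pivot6 a b c d = - a + pivot2 a b - pos (pivot2 a b)
                     + pos (pivot5 a b c d)
  & pos_cases (pivot6 a b c d).

Lemma pivotP a b c d : pivot_spec a b c d.
Proof.
split; try exact: pos_spec; last first.
- by rewrite {1}/pivot6 negE; ring.
- by rewrite {1}/pivot5 negE; ring.
- by [].
- by rewrite {1}/pivot3 negE; ring.
- by rewrite {1}/pivot2 negE; ring.
Qed.

(** First of four linear relations between the positive parts for (a, b, c, d) and for its rotation
    (b, c, d, a), in which [pos b] and [pos (pivot2 b c)] stay as free quantities. All are settled
    by sign cases, the last two with the help of the earlier ones. *)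
Lemma pos_rot3 (a b c d : int) :
  pos (pivot3 b c d)
  = pos (pivot2 a b) + pos (pivot3 a b c) + pos (pivot6 a b c d)
    - pos b - pos (pivot2 b c).
Proof.
case: (pivotP a b c d) (pivotP b c d a) =>
  ? ? ? ? ? ? ? ? ? ? ? [? ? ? ? ? _ _ _ _ _ _].
lia.
Qed.

Lemma pos_rot4 (a b c d : int) :
  pos (pivot4 b c a) = pos a + pos (pivot2 a b) + pos (pivot3 a b c).
Proof.
case: (pivotP a b c d) (pivotP b c d a) =>
  ? ? ? ? ? _ _ _ _ _ _ [? ? ? _ _ ? ? _ _ _ _].
lia.
Qed.

Lemma pos_rot5 (a b c d : int) :
  pos (pivot5 b c d a)
  = pos (pivot4 a b d) - pos (pivot2 a b) - pos (pivot3 a b c)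
    - pos (pivot6 a b c d) + pos b + pos (pivot2 b c).
Proof.
have := pos_rot3 a b c d; have := pos_rot4 a b c d.
case: (pivotP a b c d) (pivotP b c d a) =>
  ? ? ? ? ? ? ? ? ? ? ? [? ? ? ? _ ? _ ? ? _ _].
lia.
Qed.

Lemma pos_rot6 (a b c d : int) :
  pos (pivot6 b c d a)
  = pos (pivot5 a b c d) - pos (pivot2 a b) - pos (pivot6 a b c d) + pos b.
Proof.
have := pos_rot3 a b c d; have := pos_rot4 a b c d; have := pos_rot5 a b c d.
case: (pivotP a b c d) (pivotP b c d a) =>
  ? ? ? ? ? ? ? ? ? ? ? [? ? ? ? _ ? _ ? _ ? ?].
lia.
Qed.

(** A column of the folded matrix reads the cycle backwards and with opposite sign; this symmetry
    lets one formula serve both i = k and j = k. *)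
Lemma pivot6_reflect (a b c d : int) :
  pivot6 (- a) (- d) (- c) (- b) = - pivot6 a b c d.
Proof.
case: (pivotP a b c d) (pivotP (- a) (- d) (- c) (- b)) =>
  ? ? ? ? ? ? ? ? ? ? ? [? ? ? ? ? ? ? ? ? ? ?].
lia.
Qed.

(** This and the next two lemmas recognise the entries that the sixth mutation leaves at k2, k4 and
    k3. They are linear consequences of the relations [pos_rot3] to [pos_rot6]. *)
Lemma pivot6_rot1 (a b c d : int) :
  pivot6 b c d a = pivot5 a b c d - pos (pivot6 a b c d).
Proof.
have := pos_rot3 a b c d; have := pos_rot4 a b c d; have := pos_rot5 a b c d.
case: (pivotP a b c d) (pivotP b c d a) =>
  _ ? _ ? _ ? _ ? _ ? _ [_ ? _ ? _ ? _ ? _ ? _].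
lia.
Qed.

Lemma pivot6_rot2 (a b c d : int) :
  pivot6 c d a b = pivot4 a b d - pos (pivot5 a b c d).
Proof.
rewrite pivot6_rot1.
have := pos_rot3 a b c d; have := pos_rot4 a b c d.
have := pos_rot5 a b c d; have := pos_rot6 a b c d.
case: (pivotP a b c d) (pivotP b c d a) =>
  _ ? _ ? _ ? _ ? _ ? _ [_ ? _ ? _ ? _ ? _ ? _].
lia.
Qed.

Lemma pivot6_rot3 (a b c d : int) :
  pivot6 d a b c = pivot3 a b c - neg (pivot5 a b c d) - neg (pivot6 a b c d).
Proof.
rewrite pivot6_rot2 !negE.
have := pos_rot3 a b c d; have := pos_rot4 a b c d.
have := pos_rot5 a b c d; have := pos_rot6 a b c d.
case: (pivotP a b c d) (pivotP b c d a) =>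
  _ ? _ ? _ ? _ ? _ ? _ [_ ? _ ? _ ? _ ? _ ? _].
lia.
Qed.

(* The two bilinear forms agree already on all vectors satisfying the linear
   relations pos_rot*, so no case analysis is needed here. *)
Lemma pivot_sum_rot (a b c d a' b' c' d' : int) :
  pivot_sum b c d a b' c' d' a' = pivot_sum a b c d a' b' c' d'.
Proof.
rewrite /pivot_sum /wedge !circ_neg !negE.
have := pos_rot3 a b c d; have := pos_rot4 a b c d.
have := pos_rot5 a b c d; have := pos_rot6 a b c d.
have := pos_rot3 a' b' c' d'; have := pos_rot4 a' b' c' d'.
have := pos_rot5 a' b' c' d'; have := pos_rot6 a' b' c' d'.
case: (pivotP a b c d) (pivotP b c d a) =>
  _ + _ + _ + _ + _ + _ [_ + _ + _ + _ + _ + _].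
case: (pivotP a' b' c' d') (pivotP b' c' d' a') =>
  _ + _ + _ + _ + _ + _ [_ + _ + _ + _ + _ + _].
(* Positive parts and pivots become variables; substituting the relations leaves a polynomial
   identity. *)
repeat match goal with |- context[pos ?x] => move: (pos x) => ? end.
do 4![move: (pivot2 _ _) (pivot3 _ _ _) (pivot4 _ _ _) (pivot5 _ _ _ _)
            (pivot6 _ _ _ _) => ? ? ? ? ?].
move=> *; subst.
ring.
Qed.

(** * Mutation of integer matrices *)

Definition skew (T : Type) (M : T -> T -> int) := forall i j, M i j = - M j i.

(** Fomin-Zelevinsky matrix mutation, over any [eqType] so that it can be run on natural number
    labels. *)
Definition mutate (T : eqType) (M : T -> T -> int) (v : T) : T -> T -> int :=
  fun i j => if (i == v) || (j == v) then - M i j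
             else M i j + circ (M i v) (M v j).

Lemma exchange_skew (V : finType) (Q : quiver V) : skew (exchange Q).
Proof. by move=> u v; rewrite /exchange opprB. Qed.

(** Without 2-cycles the positive and negative parts of an entry count the arrows in each direction,
    so the two products in [circ] count the paths from u to w and from w to u through v. Cancelling
    2-cycles preserves the difference. *)
Lemma exchange_mutation (V : finType) (Q : quiver V) (v : V) :
  exchange (mutation Q v) =2 mutate (exchange Q) v.
Proof.
move=> u w; rewrite /exchange /= /mutation_arrows /reverse_at /mutate.
rewrite orbC /cancel_2cycles /add_paths; case: ifP => [/orP[] /eqP ->|_].
- have := quiver_loopless Q v; lia.
- have := quiver_loopless Q v; lia.
have pos_exchange a b : pos ((Q a b)%:Z - (Q b a)%:Z) = Q a b.
  by case: (quiver_no2cycle Q a b) => e;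
     case: (pos_spec ((Q a b)%:Z - (Q b a)%:Z)) => -[] ? ->; lia.
rewrite /circ !negE !pos_exchange; lia.
Qed.

Lemma eq_mutate (T : eqType) (M N : T -> T -> int) v :
  M =2 N -> mutate M v =2 mutate N v.
Proof. by move=> MN i j; rewrite /mutate !MN. Qed.

Lemma eq_foldl_mutate (T : eqType) (M N : T -> T -> int) s :
  M =2 N -> foldl (@mutate T) M s =2 foldl (@mutate T) N s.
Proof.
by elim: s M N => //= v s IH M N MN; apply: IH; apply: eq_mutate.
Qed.

Lemma exchange_mutations (V : finType) (Q : quiver V) (s : seq V) :
  exchange (foldl (@mutation V) Q s) =2 foldl (@mutate V) (exchange Q) s.
Proof.
elim: s Q => //= v s IH Q i j; rewrite IH; apply: eq_foldl_mutate.
exact: exchange_mutation.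
Qed.

(** Transports a mutation sequence to labels on which it can be computed. The labelling has to
    separate each mutated node from the other labels in [P], but two unmutated labels may name the
    same vertex. *)
Lemma mutate_comp (I T : eqType) (f : I -> T) (M : T -> T -> int)
    (P : {pred I}) (s : seq I) :
  all [in P] s -> {in s & P, forall v i, (f i == f v) = (i == v)} ->
  {in P &, forall i j, foldl (@mutate T) M (map f s) (f i) (f j)
    = foldl (@mutate I) (fun i j => M (f i) (f j)) s i j}.
Proof.
elim/last_ind: s => // s v IH; rewrite all_rcons => /andP[vP sP].
move=> f_inj i j iP jP.
have s_sub : {subset s <= rcons s v}.
  by move=> w ws; rewrite mem_rcons inE ws orbT.
have {}IH := IH sP (fun w i ws => f_inj w i (s_sub w ws)).
by rewrite map_rcons !foldl_rcons /mutate !IH ?f_inj // mem_rcons mem_head.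
Qed.

Lemma mutate_skew (T : eqType) (M : T -> T -> int) v :
  skew M -> skew (mutate M v).
Proof.
move=> Msk i j; rewrite /mutate orbC; case: ifP => _; first by rewrite Msk.
rewrite (Msk i j) (Msk i v) (Msk v j) circNN /circ; ring.
Qed.

(** * The six mutations along an oriented 4-cycle, on labels 0 to 3 *)

Definition cyc (i j : nat) : int :=
  (j == i.+1 %[mod 4])%:Z - (i == j.+1 %[mod 4])%:Z.

Lemma circ0 (x : int) : circ 0 x = 0.
Proof. by rewrite /circ /pos /neg maxxx minxx !mul0r subrr. Qed.

Lemma circ1 (x : int) : circ 1 x = pos x.
Proof. by rewrite /circ [pos 1]/= [neg 1]/= mul1r mul0r subr0. Qed.

Lemma circN1 (x : int) : circ (-1) x = neg x.
Proof. by rewrite circ_neg [pos 1]/= [neg 1]/= mul1r mul0r subr0. Qed.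

Definition path6 := [:: 0; 1; 2; 3; 1; 0]%N.

(** Mutation at v changes the entry at (i, j) using only entries among i, j and v, so the block of
    the four cycle nodes evolves on its own. *)
Lemma mutate_cyc (M : nat -> nat -> int) (s : seq nat) :
  all (ltn^~ 4) s ->
  (forall i j, (i < 4)%N -> (j < 4)%N -> M i j = cyc i j) ->
  forall i j, (i < 4)%N -> (j < 4)%N ->
    foldl (@mutate nat) M s i j = foldl (@mutate nat) cyc s i j.
Proof.
elim/last_ind: s => //= s v IH.
rewrite all_rcons => /andP[v4 s4] Mc i j i4 j4.
by rewrite !foldl_rcons /mutate !IH.
Qed.

(** Zero-based exchange of k3 and k4; the default [i] fixes every label from 4 on. *)
Definition swap23 (i : nat) : nat := nth i [:: 0; 1; 3; 2]%N i.

Lemma swap23_lt4 i : (swap23 i < 4)%N = (i < 4)%N.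
Proof. by case: i => [|[|[|[|i]]]] //; rewrite /swap23 nth_default. Qed.

Section Path6.
Variable M : nat -> nat -> int.
Hypothesis M_skew : skew M.
Hypothesis M_cyc : forall i j, (i < 4)%N -> (j < 4)%N -> M i j = cyc i j.

Let step n := foldl (@mutate nat) M (take n path6).

Let stepS n i j : (n < 6)%N ->
  step n.+1 i j = mutate (step n) (nth 0%N path6 n) i j.
Proof. by move=> n6; rewrite /step (take_nth 0%N) // foldl_rcons. Qed.

Let step_cyc n i j : (i < 4)%N -> (j < 4)%N ->
  step n i j = foldl (@mutate nat) cyc (take n path6) i j.
Proof.
move=> i4 j4; apply: mutate_cyc => //.
by apply/allP => v /mem_take; move: v; apply/allP.
Qed.

Let step_skew n : skew (step n).
Proof.
rewrite /step; elim/last_ind: (take n path6) => [|s v IH] //=.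
by rewrite foldl_rcons; apply: mutate_skew.
Qed.

Lemma foldl_path6_cyc i j : (i < 4)%N -> (j < 4)%N ->
  foldl (@mutate nat) M path6 (swap23 i) (swap23 j) = cyc i j.
Proof.
move=> i4 j4; rewrite (mutate_cyc _ M_cyc) ?swap23_lt4 //.
by case: i i4 => [|[|[|[|//]]]] _; case: j j4 => [|[|[|[|//]]]] _; vm_compute.
Qed.

Section Column.
Variable w : nat.
Hypothesis w4 : (4 <= w)%N.
Let a := M 0 w.
Let b := M 1 w.
Let c := M 2 w.
Let d := M 3 w.

(* Row n lists the entries of step n in the column of its pivot. *)
Let table : seq (seq int) :=
  [:: [:: 0; -1; 0; 1]; [:: -1; 0; -1; 1]; [:: 0; -1; 0; 0]; [:: 0; 1; 0; 0];
      [:: 1; 0; -1; 1]; [:: 0; 1; -1; 0]].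

(** A label from 4 on is never mutated, so its column evolves with the constant coefficients listed
    in [table]. *)
Let step_col n (v := nth 0%N path6 n) i : (n < 6)%N -> (i < 4)%N ->
  step n.+1 i w = if i == v then - step n i w
    else step n i w + circ (nth 0 (nth [::] table n) i) (step n v w).
Proof.
move=> n6 i4.
have v4 : (v < 4)%N by move: n n6 @v; do 6![case=> //].
have -> : nth 0 (nth [::] table n) i = step n i v.
  rewrite step_cyc // /v.
  case: n n6 {v v4} => [|[|[|[|[|[|//]]]]]] _;
    by case: i i4 => [|[|[|[|//]]]] _; vm_compute.
by rewrite stepS // /mutate -/v (gtn_eqF (leq_trans v4 w4)) orbF.
Qed.

Let col n (y0 y1 y2 y3 : int) :=
  [/\ step n 0 w = y0, step n 1 w = y1, step n 2 w = y2 & step n 3 w = y3].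

Let colS n p q r s : (n < 6)%N -> col n p q r s ->
  let y := [:: p; q; r; s] in let v := nth 0%N path6 n in
  let z i := if i == v then - nth 0 y i
             else nth 0 y i + circ (nth 0 (nth [::] table n) i) (nth 0 y v) in
  col n.+1 (z 0)%N (z 1)%N (z 2)%N (z 3)%N.
Proof.
move=> n6 [e0 e1 e2 e3] y v z.
have e i : (i < 4)%N -> step n i w = nth 0 y i.
  by case: i => [|[|[|[|//]]]] _.
have v4 : (v < 4)%N by move: n n6 @v {z e0 e1 e2 e3 e}; do 6![case=> //].
by split; rewrite step_col // !e.
Qed.

Let col0 : col 0 a b c d. Proof. by []. Qed.

Let col1 : col 1 (- a) (pivot2 a b) (c) (d + pos a).
Proof.
by have := @colS 0 _ _ _ _ isT col0; rewrite /= circ0 circ1 circN1 addr0.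
Qed.

Let col2 : col 2 (- a + neg (pivot2 a b)) (- pivot2 a b) 
  (pivot3 a b c) (pivot4 a b d).
Proof. by have := @colS 1 _ _ _ _ isT col1; rewrite /= !circN1 circ1. Qed.

Let col3 : col 3 (- a + neg (pivot2 a b)) 
  (- pivot2 a b + neg (pivot3 a b c)) (- pivot3 a b c) (pivot4 a b d).
Proof.
by have := @colS 2 _ _ _ _ isT col2; rewrite /= circN1 !circ0 !addr0.
Qed.

Let col4 : col 4 (- a + neg (pivot2 a b)) 
  (pivot5 a b c d) (- pivot3 a b c) (- pivot4 a b d).
Proof. by have := @colS 3 _ _ _ _ isT col3; rewrite /= circ1 !circ0 !addr0. Qed.

Let col5 : col 5 (pivot6 a b c d) (- pivot5 a b c d)
  (- pivot3 a b c + neg (pivot5 a b c d))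
  (- pivot4 a b d + pos (pivot5 a b c d)).
Proof. by have := @colS 4 _ _ _ _ isT col4; rewrite /= !circ1 circN1. Qed.

(** The rotations belonging to k3 and k4 come out in exchanged places, which the final relabelling
    corrects. *)
Let col6 : col 6 (- pivot6 a b c d) (- pivot6 b c d a) (- pivot6 d a b c)
  (- pivot6 c d a b).
Proof.
have := @colS 5 _ _ _ _ isT col5; rewrite /= circ1 circN1 circ0.
rewrite (pivot6_rot1 a) (pivot6_rot2 a) (pivot6_rot3 a).
by case=> e0 e1 e2 e3; split; rewrite (e0, e1, e2, e3); ring.
Qed.

Lemma foldl_path6_col i : (i < 4)%N ->
  foldl (@mutate nat) M path6 (swap23 i) w =
  - pivot6 (M i w) (M (i.+1 %% 4) w) (M (i.+2 %% 4) w) (M (i.+3 %% 4) w).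
Proof.
case: col6 => e0 e1 e2 e3; by case: i => [|[|[|[|//]]]] _.
Qed.

Lemma path6_pivots n : (n < 6)%N -> step n (nth 0%N path6 n) w =
  nth 0 [:: a; pivot2 a b; pivot3 a b c; pivot4 a b d; pivot5 a b c d;
            pivot6 a b c d] n.
Proof.
case: col1 => _ e1 _ _; case: col2 => _ _ e2 _; case: col3 => _ _ _ e3;
  case: col4 => _ e4 _ _; case: col5 => e5 _ _ _.
by case: n => [|[|[|[|[|[|//]]]]]] _.
Qed.

End Column.

(** Each step adds the wedge of the current pivots in the columns u and w, and [path6_pivots]
    identifies these pivots. *)
Lemma foldl_path6_outer u w : (4 <= u)%N -> (4 <= w)%N ->
  foldl (@mutate nat) M path6 u w = M u w
  + pivot_sum (M 0 u) (M 1 u) (M 2 u) (M 3 u) (M 0 w) (M 1 w) (M 2 w) (M 3 w).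
Proof.
move=> u4 w4.
have step_outer n (v := nth 0%N path6 n) : (n < 6)%N ->
    step n.+1 u w = step n u w + wedge (step n v u) (step n v w).
  move=> n6; have v4 : (v < 4)%N by move: n n6 @v; do 6![case=> //].
  rewrite stepS // /mutate -/v !gtn_eqF ?(leq_trans v4) //=.
  by rewrite /wedge -step_skew.
rewrite -[LHS]/(step 6 u w) (step_outer 5) // (step_outer 4) //.
rewrite (step_outer 3) // (step_outer 2) // (step_outer 1) // (step_outer 0) //.
by rewrite !path6_pivots // /pivot_sum !addrA.
Qed.

End Path6.

(** * The oriented 4-cycle *)

Section FourCycle.
Variables (V : finType) (Q : quiver V) (k : nat -> V).
Hypothesis k_eq : forall i j, (k i == k j) = (i == j %[mod 4]).
Hypothesis Q_cyc : forall i j, exchange Q (k i) (k j) = cyc i j.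

Let Q6 := foldl (@mutation V) Q (map k path6).
Let Q' := relabel (tperm (k 2) (k 3)) Q6.

Definition off_cycle (u : V) := forall i, k i != u.

Let k_mod i : k i = k (i %% 4).
Proof. by apply/eqP; rewrite k_eq modn_mod. Qed.

Let exchange_relabel u w : exchange Q' u w
  = exchange Q6 (tperm (k 2) (k 3) u) (tperm (k 2) (k 3) w).
Proof. by rewrite /exchange /= /relabel_arrows tpermV. Qed.

Let relabel_cycle i : (i < 4)%N -> tperm (k 2) (k 3) (k i) = k (swap23 i).
Proof.
case: i => [|[|[|[|//]]]] _; rewrite ?tpermL ?tpermR //;
  by rewrite tpermD // k_eq.
Qed.

Let relabel_off u : off_cycle u -> tperm (k 2) (k 3) u = u.
Proof. by move=> offu; rewrite tpermD. Qed.

Lemma exchange_cycle i j : exchange Q' (k i) (k j) = cyc i j.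
Proof.
have cyc_mod a b : cyc (a %% 4) (b %% 4) = cyc a b by rewrite -!Q_cyc -!k_mod.
have [i4 j4] : (i %% 4 < 4)%N /\ (j %% 4 < 4)%N by rewrite !ltn_mod.
rewrite (k_mod i) (k_mod j) -cyc_mod exchange_relabel !relabel_cycle //.
rewrite exchange_mutations (@mutate_comp _ _ k _ (gtn 4)) //; first last.
- by rewrite inE swap23_lt4.
- by rewrite inE swap23_lt4.
- move=> v a v_path; rewrite inE => a4; rewrite k_eq !modn_small //.
  by move: v v_path; apply/allP.
by rewrite foldl_path6_cyc // => a b *; rewrite ?Q_cyc // exchange_skew.
Qed.

Section Off.
Variables u w : V.
Hypotheses (offu : off_cycle u) (offw : off_cycle w).

(** Label 4 is [u]; label 5 and, by the default of [nth], every larger one is [w]. The two vertices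
    may coincide. *)
Let node n := nth w [:: k 0; k 1; k 2; k 3; u] n.
Let M i j := exchange Q (node i) (node j).

Let node_cycle i : (i < 4)%N -> node i = k i.
Proof. by case: i => [|[|[|[|//]]]]. Qed.

Let exchange_foldl i j :
  exchange Q6 (node i) (node j) = foldl (@mutate nat) M path6 i j.
Proof.
rewrite exchange_mutations -(@mutate_comp _ _ node _ predT) //.
move=> v a v_path _; have v4 : (v < 4)%N by move: v v_path; apply/allP.
have [a4|a4] := ltnP a 4; first by rewrite !node_cycle // k_eq !modn_small.
rewrite (gtn_eqF (leq_trans v4 a4)) (node_cycle v4) eq_sym; apply/negbTE.
by case: a a4 => [|[|[|[|[|a]]]]] //= _; rewrite /node /= ?nth_nil.
Qed.

Let M_skew : skew M.
Proof. by move=> i j; rewrite /M exchange_skew. Qed.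

Let M_cyc i j : (i < 4)%N -> (j < 4)%N -> M i j = cyc i j.
Proof. by move=> i4 j4; rewrite /M !node_cycle ?Q_cyc. Qed.

Lemma exchange_cycle_off2 i : exchange Q' (k i) w =
  - pivot6 (exchange Q (k i) w) (exchange Q (k i.+1) w)
           (exchange Q (k i.+2) w) (exchange Q (k i.+3) w).
Proof.
have i4 : (i %% 4 < 4)%N by rewrite ltn_mod.
rewrite (k_mod i) exchange_relabel relabel_cycle // relabel_off //.
rewrite -node_cycle ?swap23_lt4 // [w in LHS](_ : w = node 5) //.
rewrite exchange_foldl foldl_path6_col // /M -[node 5]/w.
rewrite !node_cycle ?ltn_mod //.
have kS n : k ((n + i %% 4) %% 4) = k (n + i).
  by apply/eqP; rewrite k_eq modn_mod modnDmr.
by rewrite (kS 1) (kS 2) (kS 3).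
Qed.

Lemma exchange_off : exchange Q' u w = exchange Q u w +
  pivot_sum (exchange Q (k 0) u) (exchange Q (k 1) u)
            (exchange Q (k 2) u) (exchange Q (k 3) u)
            (exchange Q (k 0) w) (exchange Q (k 1) w)
            (exchange Q (k 2) w) (exchange Q (k 3) w).
Proof.
rewrite exchange_relabel !relabel_off // [in LHS](_ : u = node 4) //.
rewrite [in LHS](_ : w = node 5) // exchange_foldl.
exact: foldl_path6_outer.
Qed.

End Off.

(** Here [w] also fills the slot of the second off-cycle vertex in the labelling. *)
Lemma exchange_cycle_off w i : off_cycle w -> exchange Q' (k i) w =
  - pivot6 (exchange Q (k i) w) (exchange Q (k i.+1) w)
           (exchange Q (k i.+2) w) (exchange Q (k i.+3) w).
Proof. by move=> offw; apply: (exchange_cycle_off2 offw offw). Qed.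

End FourCycle.

(** * Group ring elements as functions *)

Section LeftAction.
Variables (gT : finGroupType) (V : finType) (to : {action gT &-> V}).

Lemma lact1 u : lact to 1 u = u.
Proof. by rewrite /lact invg1 act1. Qed.

Lemma lactM g h u : lact to (g * h) u = lact to g (lact to h u).
Proof. by rewrite /lact invMg actM. Qed.

Lemma exchange_lact_move (Q : quiver V) g u v : quiver_invariant to Q ->
  exchange Q u (lact to g v) = exchange Q (lact to g^-1 u) v.
Proof. by move=> Qinv; rewrite -(Qinv g^-1%g) -lactM mulVg lact1. Qed.

End LeftAction.

Lemma mul_gr_elt (R : comNzRingType) (gT : finGroupType)
    (a : group_ring R gT) (g h : gT) : (a * gr_elt g) h = a (h * g^-1)%g.
Proof.
rewrite ffunE (bigD1 (h * g^-1)%g) //= ffunE invMg invgK mulgKV eqxx mulr1.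
rewrite big1 ?addr0 // => t th; rewrite ffunE.
case: eqP => [e|_]; last by rewrite mulr0.
by rewrite -e invMg invgK mulKVg eqxx in th.
Qed.

Lemma gr_eltX (R : comNzRingType) (gT : finGroupType) (g : gT) n :
  gr_elt g ^+ n = gr_elt (g ^+ n) :> group_ring R gT.
Proof.
elim: n => [|n IH] //.
rewrite exprSr IH; apply/ffunP => h; rewrite mul_gr_elt !ffunE expgSr.
by rewrite -(can_eq (mulgK g) _ (g ^+ n)%g) mulgKV.
Qed.

Section Represents.
Variables (R : realDomainType) (gT : finGroupType).
Implicit Types (r s : R) (a b : group_ring R gT) (y : gT -> int).

(** The scalar 1/|H_j| of column j is split off, leaving an integer function on G. As this scalar is
    nonnegative, positive and negative parts act on the integer function alone. *)
Definition represents r a y := forall g, a g = r * (y g)%:~R.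

Lemma represents_inj r a b y z : represents r a y -> represents r b z ->
  y =1 z -> a = b.
Proof. by move=> ay bz yz; apply/ffunP => g; rewrite ay bz yz. Qed.

Lemma representsD r a b y z : represents r a y -> represents r b z ->
  represents r (a + b) (fun g => y g + z g).
Proof. by move=> ay bz g; rewrite ffunE ay bz -mulrDr intrD. Qed.

Lemma representsN r a y : represents r a y ->
  represents r (- a) (fun g => - y g).
Proof. by move=> ay g; rewrite ffunE ay intrN mulrN. Qed.

Lemma represents_pos r a y : 0 <= r -> represents r a y ->
  represents r [a]_+ (fun g => pos (y g)).
Proof.
move=> r0 ay g; rewrite ffunE ay /pos; case: (leP (y g) 0) => y0.
  by rewrite mulr0 max_r // mulr_ge0_le0 // lerz0.
by rewrite max_l // mulr_ge0 // ler0z ltW.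
Qed.

Lemma represents_neg r a y : 0 <= r -> represents r a y ->
  represents r [a]_- (fun g => neg (y g)).
Proof.
move=> r0 ay.
have -> : [a]_- = a - [a]_+.
  by apply/ffunP => g; rewrite !ffunE; exact: negE.
move=> g; rewrite negE.
exact: (representsD ay (representsN (represents_pos r0 ay))).
Qed.

Lemma represents_circ r s a b y z : 0 <= r -> 0 <= s ->
  represents r a y -> represents s b z ->
  represents (r * s) (a ∘ b)
    (fun g => \sum_t circ (y t) (z (t^-1 * g)%g)).
Proof.
move=> r0 s0 ay bz g; rewrite !ffunE rmorph_sum mulr_sumr -sumrB.
apply: eq_bigr => t _.
rewrite (represents_pos r0 ay) (represents_neg r0 ay).
rewrite (represents_pos s0 bz) (represents_neg s0 bz).
rewrite /circ rmorphB !rmorphM /=; ring.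
Qed.

Lemma represents_pivot2 r a b y z : 0 <= r ->
  represents r a y -> represents r b z ->
  represents r (b + [a]_-) (fun g => pivot2 (y g) (z g)).
Proof. by move=> r0 ay bz; apply: representsD bz (represents_neg r0 ay). Qed.

Section Pivots.
Variables (r : R) (a b c d : group_ring R gT) (y1 y2 y3 y4 : gT -> int).
Hypotheses (r0 : 0 <= r) (ay : represents r a y1) (by2 : represents r b y2)
  (cy : represents r c y3) (dy : represents r d y4).
Let r2 := represents_pivot2 r0 ay by2.

Lemma represents_pivot3 : represents r (c + [b + [a]_-]_-)
  (fun g => pivot3 (y1 g) (y2 g) (y3 g)).
Proof. exact: representsD cy (represents_neg r0 r2). Qed.

Lemma represents_pivot4 : represents r (d + [a]_+ + [b + [a]_-]_+)
  (fun g => pivot4 (y1 g) (y2 g) (y4 g)).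
Proof.
apply: representsD (represents_pos r0 r2).
exact: representsD dy (represents_pos r0 ay).
Qed.

Lemma represents_pivot5 : represents r
  (- b - [a]_- + [c + [b + [a]_-]_-]_- + [d + [a]_+ + [b + [a]_-]_+]_+)
  (fun g => pivot5 (y1 g) (y2 g) (y3 g) (y4 g)).
Proof.
rewrite -opprD; apply: representsD (represents_pos r0 represents_pivot4).
exact: representsD (representsN r2) (represents_neg r0 represents_pivot3).
Qed.

Lemma represents_pivot6 : represents r
  (a - [b + [a]_-]_-
   - [- b - [a]_- + [c + [b + [a]_-]_-]_- + [d + [a]_+ + [b + [a]_-]_+]_+]_+)
  (fun g => - pivot6 (y1 g) (y2 g) (y3 g) (y4 g)).
Proof.
move=> g; rewrite /pivot6 !opprD opprK; move: g.
apply: representsD (representsN (represents_pos r0 represents_pivot5)).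
exact: representsD ay (representsN (represents_neg r0 r2)).
Qed.

End Pivots.

Lemma gr_posN a : [- a]_+ = - [a]_-.
Proof. by apply/ffunP => g; rewrite !ffunE; apply: posN. Qed.

Lemma gr_negN a : [- a]_- = - [a]_+.
Proof. by apply/ffunP => g; rewrite !ffunE; apply: negN. Qed.

(** Pivots are entries from the orbit to u, whereas a left factor holds entries from u to the orbit.
    By skew symmetry it is [- a] that represents the pivot, which turns [circ] into [wedge]. *)
Lemma represents_wedge s a b y z : 0 <= s ->
  represents 1 (- a) y -> represents s b z ->
  represents s (a ∘ b) (fun g => \sum_t wedge (y t) (z (t^-1 * g)%g)).
Proof.
move=> s0 ay bz; rewrite -[s in represents s]mul1r.
have {}ay : represents 1 a (fun g => - y g).
  by rewrite -[a]opprK; apply: representsN.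
by have := represents_circ ler01 s0 ay bz.
Qed.

End Represents.

Lemma folded_matrixE (gT : finGroupType) (V : finType) (to : {action gT &-> V})
    (Q : quiver V) (m : nat) (x : 'I_m -> V) i j :
  represents (#|('C[x j | to])%g|%:R^-1) (folded_matrix to Q x i j)
    (fun g => exchange Q (x i) (lact to g (x j))).
Proof.
move=> g; rewrite mxE ffunE; congr (_ * _).
rewrite sum_ffunE (bigD1 g) //= !ffunE eqxx mulr1 big1 ?addr0 // => h hg.
by rewrite !ffunE eq_sym (negbTE hg) mulr0.
Qed.

(** * The generalized mutation *)

Section Orbit4.
Variables (gT : finGroupType) (zeta : gT).
Hypothesis zeta_gen : [set: gT] = <[zeta]>%g.
Hypothesis zeta_order : #[zeta]%g = 4%N.
Variables (V : finType) (to : {action gT &-> V}) (Q : quiver V).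
Hypothesis Q_inv : quiver_invariant to Q.
Variable x : V.

Definition node n := lact to (zeta ^+ n) x.

Lemma zetaP g : exists2 n, (n < 4)%N & g = (zeta ^+ n)%g.
Proof.
have /cyclePmin[n n4 ->] : g \in <[zeta]>%g by rewrite -zeta_gen inE.
by exists n; rewrite -?zeta_order.
Qed.

Lemma zetaC g n : commute g (zeta ^+ n)%g.
Proof. by have [m _ ->] := zetaP g; apply: commuteX2. Qed.

Lemma lact_node n i : lact to (zeta ^+ n) (node i) = node (n + i).
Proof. by rewrite /node -lactM expgD. Qed.

Lemma lact_nodeS i : lact to zeta (node i) = node i.+1.
Proof. by rewrite -(lact_node 1) expg1. Qed.

Lemma exchange_nodeS i u :
  exchange Q (node i.+1) (lact to zeta u) = exchange Q (node i) u.
Proof. by rewrite -lact_nodeS Q_inv. Qed.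

Lemma exchange_node_shift n i u :
  exchange Q (node (n + i)) (lact to (zeta ^+ n) u) = exchange Q (node i) u.
Proof. by rewrite -lact_node Q_inv. Qed.

Let node_mod i : node i = node (i %% 4).
Proof. by rewrite /node -zeta_order expg_mod_order. Qed.

(** Any coincidence within the orbit forces zeta^2 to fix x, and then node 1 and node 3 would be
    equal. *)
Lemma node_eq_mod4 :
  exchange Q x (node 1) != exchange Q x (node 3) ->
  forall i j, (node i == node j) = (i == j %[mod 4]).
Proof.
move=> nodeN i j; apply/eqP/eqP => [e|e]; last by rewrite node_mod e -node_mod.
have node_add n a b : node a = node b -> node (n + a) = node (n + b).
  by rewrite -!lact_node => ->.
have node20 : node 2 <> node 0.
  move/(node_add 1%N)/(congr1 (exchange Q x)) => e31.
  by rewrite e31 eqxx in nodeN.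
(* Since 3 is -1 modulo 4, this is i - j modulo 4. *)
pose m := ((i + 3 * j) %% 4)%N.
have m4 : (m < 4)%N by rewrite ltn_mod.
have nm : node m = node 0.
  by rewrite -node_mod addnC (node_add _ _ _ e) node_mod; congr node; lia.
have m0 : m = 0%N -> i = j %[mod 4] by lia.
clearbody m; case: m m4 nm m0 => [|[|[|[|//]]]] _ nm m0; first exact: m0.
- by case: node20; rewrite (node_add 1 _ _ nm).
- by case: node20.
(* From node 3 = node 0 follows node 6 = node 3, and 6 is 2 modulo 4. *)
by case: node20; rewrite -nm -(node_add 3 _ _ nm) (node_mod 6).
Qed.

Lemma card_astab1_node :
  (forall i j, (node i == node j) = (i == j %[mod 4])) ->
  #|('C[x | to])%g| = 1%N.
Proof.
move=> node_eq; rewrite (_ : ('C[x | to])%g = [set 1%g]) ?cards1 //.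
apply/setP => g; rewrite in_set1.
apply/idP/eqP => [/astab1P gx|->]; last by rewrite group1.
have [n n4 eg] := zetaP g^-1%g.
have : node n == node 0 by rewrite /node -eg /lact invgK gx expg0 invg1 act1.
rewrite node_eq !modn_small // => /eqP n0.
by rewrite -[g]invgK eg n0 expg0 invg1.
Qed.

Lemma exchange_node_cyc :
  (forall n, (n < 4)%N -> exchange Q x (node n) = cyc 0 n) ->
  forall i j, exchange Q (node i) (node j) = cyc i j.
Proof.
(* The exponent 3i acts as -i and brings node i back to x. *)
move=> Qx i j; rewrite -(exchange_node_shift (3 * i)) lact_node.
have -> : node (3 * i + i) = x.
  by rewrite -mulSnr node_mod modnMr; apply: lact1.
rewrite (node_mod (_ + _)) Qx ?ltn_mod // /cyc.
by congr (_%:Z - _%:Z); apply/eqP/eqP; lia.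
Qed.

Hypothesis node_eq : forall i j, (node i == node j) = (i == j %[mod 4]).
Hypothesis Q_cyc : forall i j, exchange Q (node i) (node j) = cyc i j.

Lemma off_lact g u : off_cycle node u -> off_cycle node (lact to g u).
Proof.
have [n _ ->] := zetaP g => offu i.
(* The exponent 3n inverts zeta^n: if zeta^n u were node i, then u would be node 3n + i. *)
apply: contra (offu (n * 3 + i)%N) => /eqP e.
by rewrite -lact_node e -lactM -expgD -mulnSr mulnC -zeta_order expgM
  expg_order expg1n lact1.
Qed.

Lemma on_or_off u : (exists i, u = node i) \/ off_cycle node u.
Proof.
case: (boolP [exists i : 'I_4, node i == u]) => [/existsP[i /eqP <-]|].
  by left; exists i.
rewrite negb_exists => /forallP h; right=> i.
have := h (inord (i %% 4)); rewrite inordK ?ltn_mod //.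
suff -> : node (i %% 4) = node i by [].
by apply/eqP; rewrite node_eq modn_mod.
Qed.

Let Q' := generalized_mutation to zeta Q x.

Lemma generalized_mutationE :
  Q' = relabel (tperm (node 2) (node 3))
         (foldl (@mutation V) Q (map node path6)).
Proof.
rewrite /Q' /generalized_mutation /= /node.
by rewrite -[lact to (zeta ^+ 0) x]/(lact to 1 x) !lact1.
Qed.

Lemma generalized_mutation_invariant : quiver_invariant to Q'.
Proof.
have inv_cyc i u :
    exchange Q' (node i.+1) (lact to zeta u) = exchange Q' (node i) u.
  have [[j ->]|offu] := on_or_off u.
    rewrite lact_nodeS generalized_mutationE.
    rewrite !exchange_cycle //.
    by rewrite /cyc !(eqn_modDl 1).
  rewrite generalized_mutationE !exchange_cycle_off //; last exact: off_lact.
  by rewrite !exchange_nodeS.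
suff inv_zeta u w :
    exchange Q' (lact to zeta u) (lact to zeta w) = exchange Q' u w.
  move=> g u w; have [n _ ->] := zetaP g.
  elim: n => [|n IH]; first by rewrite !lact1.
  by rewrite expgS !lactM inv_zeta.
have [[i ->]|offu] := on_or_off u; first by rewrite lact_nodeS inv_cyc.
have [[i ->]|offw] := on_or_off w.
  by rewrite exchange_skew lact_nodeS inv_cyc [RHS]exchange_skew.
rewrite generalized_mutationE !exchange_off //; try exact: off_lact.
rewrite Q_inv; congr (_ + _).
(* Writing node 0 as node 4 lets all four indices drop by one, which rotates both vectors. *)
have n0 v : exchange Q (node 0) v = exchange Q (node 4) v.
  by congr exchange; apply/eqP; rewrite node_eq.
by rewrite (n0 (lact _ _ u)) (n0 (lact _ _ w)) !exchange_nodeS -pivot_sum_rot.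
Qed.

(** * Folded entries of the mutated quiver *)

Section Folding.
Variable R : realDomainType.
Implicit Types (r : R) (a b : group_ring R gT).

Let node0 : node 0 = x. Proof. exact: lact1. Qed.

(** The coefficient at g becomes the entry from x to zeta^-n g w, as G is commutative; invariance
    moves zeta^n to the first argument. *)
Lemma represents_row n r a (w : V) :
  represents r a (fun g => exchange Q x (lact to g w)) ->
  represents r (a * gr_elt (zeta ^+ n)%g)
    (fun g => exchange Q (node n) (lact to g w)).
Proof.
move=> aE g; rewrite mul_gr_elt aE; congr (_ * _%:~R).
have -> : (g * (zeta ^+ n)^-1 = (zeta ^+ n)^-1 * g)%g.
  exact/commuteV/zetaC.
by rewrite lactM (exchange_lact_move _ _ _ Q_inv) invgK.
Qed.

(** Here zeta^-n hits x itself and equals zeta^p. Thus a column runs through the orbit in the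
    opposite direction to a row. *)
Lemma represents_col n p r a (u : V) : (n + p = 4)%N ->
  represents r a (fun g => exchange Q u (lact to g x)) ->
  represents r (a * gr_elt (zeta ^+ n)%g)
    (fun g => - exchange Q (node p) (lact to g^-1 u)).
Proof.
move=> np aE g; rewrite mul_gr_elt aE lactM (exchange_lact_move _ _ _ Q_inv).
rewrite exchange_skew; congr (_ * (- exchange _ _ _)%:~R).
rewrite /node; congr lact; apply/eqP; rewrite eq_invg_mul -expgD np.
by rewrite -zeta_order expg_order.
Qed.

Let zV : (zeta^-1 = zeta ^+ 3)%g.
Proof. by apply/eqP; rewrite eq_invg_mul -expgS -zeta_order expg_order. Qed.

Let z1 : gr_elt zeta = gr_elt (zeta ^+ 1)%g :> group_ring R gT.
Proof. by rewrite expg1. Qed.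

Definition folded_incident a : group_ring R gT :=
  a - [a * gr_elt zeta + [a]_-]_-
  - [- a * gr_elt zeta - [a]_-
     + [a * gr_elt zeta ^+ 2 + [a * gr_elt zeta + [a]_-]_-]_-
     + [a * gr_elt zeta ^+ 3 + [a]_+ + [a * gr_elt zeta + [a]_-]_+]_+]_+.

Lemma represents_incident_row r a w : 0 <= r ->
  represents r a (fun g => exchange Q x (lact to g w)) ->
  represents r (folded_incident a) (fun g => - pivot6
    (exchange Q (node 0) (lact to g w)) (exchange Q (node 1) (lact to g w))
    (exchange Q (node 2) (lact to g w)) (exchange Q (node 3) (lact to g w))).
Proof.
move=> r0 aE; rewrite /folded_incident mulNr !gr_eltX z1 node0.
exact: represents_pivot6 r0 aE (represents_row 1 aE) (represents_row 2 aE)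
  (represents_row 3 aE).
Qed.

(** The powers of zeta supply the negated entries at nodes 0, 3, 2, 1, which [pivot6_reflect] puts
    back in order. *)
Lemma represents_incident_col r a u : 0 <= r ->
  represents r a (fun g => exchange Q u (lact to g x)) ->
  represents r (folded_incident a) (fun g => pivot6
    (exchange Q (node 0) (lact to g^-1 u))
    (exchange Q (node 1) (lact to g^-1 u))
    (exchange Q (node 2) (lact to g^-1 u))
    (exchange Q (node 3) (lact to g^-1 u))).
Proof.
move=> r0 aE g; rewrite -[X in X%:~R]opprK -pivot6_reflect; move: g.
rewrite /folded_incident mulNr !gr_eltX z1.
have a0 : represents r a (fun g => - exchange Q (node 0) (lact to g^-1 u)).
  by move=> g; rewrite aE (exchange_lact_move _ _ _ Q_inv) node0 -exchange_skew.
exact: (represents_pivot6 r0 a0 (@represents_col 1 3 _ _ _ erefl aE)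
  (@represents_col 2 2 _ _ _ erefl aE) (@represents_col 3 1 _ _ _ erefl aE)).
Qed.

(** Each product sums a wedge of pivots over t in G. Together the six give, for every t, the change
    of one and the same entry by invariance, so the sum is four times that change and the factor 1/4
    recovers it. *)
Lemma folded_off r a b c a' b' c' u w : 0 <= r -> (4%:R : R) \is a GRing.unit ->
  off_cycle node u -> off_cycle node w ->
  represents 1 a (fun g => exchange Q u (lact to g x)) ->
  represents r b (fun g => exchange Q x (lact to g w)) ->
  represents r c (fun g => exchange Q u (lact to g w)) ->
  represents 1 a' (fun g => exchange Q' u (lact to g x)) ->
  represents r b' (fun g => exchange Q' x (lact to g w)) ->
  represents r c' (fun g => exchange Q' u (lact to g w)) ->
  let z := gr_elt zeta in
  let zV := gr_elt zeta^-1 in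
  c' = c + 4%:R^-1 *:
    (a ∘ b - a' ∘ b'
     + (a * zV + [a]_+) ∘ (b * z + [b]_-)
     + (a * z ^+ 2 + [a * zV + [a]_+]_+) ∘ (b * z ^+ 2 + [b * z + [b]_-]_-)
     + (a * z + [a]_- + [a * zV + [a]_+]_-)
       ∘ (b * zV + [b]_+ + [b * z + [b]_-]_+)
     + (- a * zV - [a]_+ + [a * z ^+ 2 + [a * zV + [a]_+]_+]_+
        + [a * z + [a]_- + [a * zV + [a]_+]_-]_-)
       ∘ (- b * z - [b]_- + [b * z ^+ 2 + [b * z + [b]_-]_-]_-
          + [b * zV + [b]_+ + [b * z + [b]_-]_+]_+)).
Proof.
move=> r0 unit4 offu offw aE bE cE a'E b'E c'E z zV'.
have Q'_inv := generalized_mutation_invariant.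
(* The exponent 4 - n and the sign make [A n] represent the entries from node n to the translates of
   u. *)
pose A n := - a * gr_elt (zeta ^+ (4 - n))%g.
pose p n g := exchange Q (node n) (lact to g^-1 u).
pose q n g := exchange Q (node n) (lact to g w).
have AE n : (n <= 4)%N -> represents 1 (A n) (p n).
  move=> n4 g; rewrite /A mulNr ffunE.
  by rewrite (represents_col (subnK n4) aE) mul1r mul1r intrN opprK.
have a0 : represents 1 (- a) (p 0%N).
  move=> g; rewrite ffunE aE (exchange_lact_move _ _ _ Q_inv) exchange_skew.
  by rewrite !mul1r intrN opprK /p node0.
have b0 : represents r b (q 0%N) by rewrite /q node0.
have bE' n : represents r (b * gr_elt (zeta ^+ n)%g) (q n).
  exact: represents_row.
have one0 : (0 : R) <= 1 := ler01.
have A3 : A 3 = - (a * z) by rewrite /A mulNr expg1.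
have A2 : A 2 = - (a * z ^+ 2) by rewrite /A mulNr gr_eltX.
have A1 : A 1 = - (a * zV') by rewrite /A mulNr /zV' zV.
(* The pivots built from [- a] are the negatives of the displayed left factors, because negation
   exchanges the two parts. *)
have e2 : A 1 + [- a]_- = - (a * zV' + [a]_+) by rewrite A1 gr_negN opprD.
have e3 : A 2 + [A 1 + [- a]_-]_- = - (a * z ^+ 2 + [a * zV' + [a]_+]_+).
  by rewrite e2 gr_negN A2 opprD.
have e4 : A 3 + [- a]_+ + [A 1 + [- a]_-]_+
    = - (a * z + [a]_- + [a * zV' + [a]_+]_-).
  by rewrite e2 !gr_posN A3 !opprD.
have e5 : - A 1 - [- a]_- + [A 2 + [A 1 + [- a]_-]_-]_-
      + [A 3 + [- a]_+ + [A 1 + [- a]_-]_+]_+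
    = - (- a * zV' - [a]_+ + [a * z ^+ 2 + [a * zV' + [a]_+]_+]_+
         + [a * z + [a]_- + [a * zV' + [a]_+]_-]_-).
  by rewrite -opprD e4 e3 e2 gr_posN gr_negN !opprD !opprK mulNr opprK.
have p2 := represents_pivot2 one0 a0 (AE 1 isT).
have p3 := represents_pivot3 one0 a0 (AE 1 isT) (AE 2 isT).
have p4 := represents_pivot4 one0 a0 (AE 1 isT) (AE 3 isT).
have p5 := represents_pivot5 one0 a0 (AE 1 isT) (AE 2 isT) (AE 3 isT).
rewrite e2 in p2; rewrite e3 in p3; rewrite e4 in p4; rewrite e5 in p5.
have q2 := represents_pivot2 r0 b0 (bE' 1).
have q3 := represents_pivot3 r0 b0 (bE' 1) (bE' 2).
have q4 := represents_pivot4 r0 b0 (bE' 1) (bE' 3).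
have q5 := represents_pivot5 r0 b0 (bE' 1) (bE' 2) (bE' 3).
(* Both mutated entries are minus the sixth pivot; negating both arguments negates the wedge, whence
   the minus sign before the product of [a'] and [b']. *)
have a'0 : represents 1 (- a') (fun g =>
    - pivot6 (p 0 g) (p 1 g) (p 2 g) (p 3 g))%N.
  move=> g; rewrite ffunE a'E (exchange_lact_move _ _ _ Q'_inv).
  rewrite exchange_skew -node0.
  rewrite generalized_mutationE exchange_cycle_off //; last exact: off_lact.
  by rewrite !mul1r !intrN opprK.
have b'0 : represents r b' (fun g =>
    - pivot6 (q 0 g) (q 1 g) (q 2 g) (q 3 g))%N.
  move=> g; rewrite b'E -node0 generalized_mutationE exchange_cycle_off //.
  exact: off_lact.
have := representsD (representsD (representsD (representsD (representsD
  (represents_wedge r0 a0 b0) (representsN (represents_wedge r0 a'0 b'0)))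
  (represents_wedge r0 p2 q2)) (represents_wedge r0 p3 q3))
  (represents_wedge r0 p4 q4)) (represents_wedge r0 p5 q5).
rewrite -zV -!gr_eltX !expr1 -/z -/zV' -!mulNr => S_E.
apply/ffunP => g; rewrite ffunE [X in _ = _ + X]ffunE S_E cE c'E.
rewrite -sumrN -!big_split /=.
rewrite (eq_bigr
  (fun=> exchange Q' u (lact to g w) - exchange Q u (lact to g w))).
  rewrite sumr_const; have -> : #|gT| = 4%N by rewrite -cardsT zeta_gen -orderE.
  rewrite rmorphMn /= -[(_ - _)%:~R *+ 4]mulr_natl mulrCA mulKr //.
  by rewrite -mulrDr -intrD addrC subrK.
move=> t _.
(* Translating by t^-1 makes the summand the local change between t^-1 u and t^-1 g w. *)
rewrite -(Q_inv t^-1%g u) -(Q'_inv t^-1%g u) -lactM.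
rewrite generalized_mutationE exchange_off //; try exact: off_lact.
rewrite /p /q /pivot_sum /wedge circNN; ring.
Qed.

End Folding.

End Orbit4.

(** * From the condition on [b_kk] to the folded formulas *)

Theorem proposition4p12
  (gT : finGroupType) (zeta : gT)
  (zeta_gen : [set: gT] = <[zeta]>%g) (zeta_order : #[zeta]%g = 4%N)
  (V : finType) (to : {action gT &-> V})
  (Q : quiver V) (Q_inv : quiver_invariant to Q)
  (m : nat) (O : 'I_m -> {set V}) (O_inj : injective O)
  (O_orbits : [set O i | i : 'I_m] = [set orbit to [set: gT] u | u : V])
  (x : 'I_m -> V) (x_repr : forall i, x i \in O i)
  (k : 'I_m)
  (b_kk : folded_matrix to Q x k k = gr_elt zeta - gr_elt zeta^-1) :
  let z : group_ring (Zinv #|gT|) gT := gr_elt zeta in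
  let zV : group_ring (Zinv #|gT|) gT := gr_elt zeta^-1 in
  let Q' := generalized_mutation to zeta Q (x k) in
  let b := folded_matrix to Q x in
  let b' := folded_matrix to Q' x in
  quiver_invariant to Q' /\
  (forall i j : 'I_m, i = k \/ j = k ->
     b' i j =
       b i j - [b i j * z + [b i j]_-]_-
       - [- b i j * z - [b i j]_-
          + [b i j * z ^+ 2 + [b i j * z + [b i j]_-]_-]_-
          + [b i j * z ^+ 3 + [b i j]_+ + [b i j * z + [b i j]_-]_+]_+]_+) /\
  (forall i j : 'I_m, i <> k -> j <> k ->
     b' i j =
       b i j + (4%:R : Zinv #|gT|)^-1 *:
         (b i k ∘ b k j - b' i k ∘ b' k j
          + (b i k * zV + [b i k]_+) ∘ (b k j * z + [b k j]_-)
          + (b i k * z ^+ 2 + [b i k * zV + [b i k]_+]_+)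
            ∘ (b k j * z ^+ 2 + [b k j * z + [b k j]_-]_-)
          + (b i k * z + [b i k]_- + [b i k * zV + [b i k]_+]_-)
            ∘ (b k j * zV + [b k j]_+ + [b k j * z + [b k j]_-]_+)
          + (- b i k * zV - [b i k]_+
             + [b i k * z ^+ 2 + [b i k * zV + [b i k]_+]_+]_+
             + [b i k * z + [b i k]_- + [b i k * zV + [b i k]_+]_-]_-)
            ∘ (- b k j * z - [b k j]_-
               + [b k j * z ^+ 2 + [b k j * z + [b k j]_-]_-]_-
               + [b k j * zV + [b k j]_+ + [b k j * z + [b k j]_-]_+]_+))).
Proof.
move=> z zV Q' b b'.
pose r j : Zinv #|gT| := #|('C[x j | to])%g|%:R^-1.
have r0 j : 0 <= r j by rewrite invr_ge0.
have bE i j := folded_matrixE to Q x i j : represents (r j) _ _.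
have b'E i j := folded_matrixE to Q' x i j : represents (r j) _ _.
have zeta_neq : zeta != (zeta^-1)%g.
  by rewrite eq_sym eq_invg_mul -{2}[zeta]expg1 -expgS -order_dvdn zeta_order.
have b_kkE g : r k * (exchange Q (x k) (lact to g (x k)))%:~R
    = (g == zeta)%:R - (g == zeta^-1)%g%:R.
  by rewrite -bE b_kk !ffunE.
have zetaV : (zeta^-1 = zeta ^+ 3)%g.
  by apply/eqP; rewrite eq_invg_mul -expgS -zeta_order expg_order.
pose nd := node zeta to (x k).
have node_eq : forall i j, (nd i == nd j) = (i == j %[mod 4]).
  (* Were the entries at zeta x and zeta^3 x equal, so would be the coefficients of [b_kk] at zeta
     and zeta^-1, which are 1 and -1. The scalar [r k] need not be known yet. *)
  apply: (node_eq_mod4 zeta_order (Q := Q)); apply/eqP => e.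
  have := b_kkE (zeta ^+ 1)%g; rewrite [lact _ _ _]/(node zeta to (x k) 1) e.
  rewrite [X in exchange _ _ X]/(lact to (zeta ^+ 3)%g (x k)) b_kkE.
  rewrite expg1 -zetaV !eqxx eq_sym (negbTE zeta_neq) sub0r subr0 => /eqP.
  by rewrite eq_sym -addr_eq0 (pnatr_eq0 _ 2).
(* The orbit is free, so the coefficients of [b_kk] are the exchange entries themselves. *)
have rk1 : r k = 1 by rewrite /r (card_astab1_node zeta_gen) // invr1.
have Q_cyc : forall i j, exchange Q (nd i) (nd j) = cyc i j.
  apply: exchange_node_cyc => // n n4; apply: (@intr_inj (Zinv #|gT|)).
  have := b_kkE (zeta ^+ n)%g; rewrite rk1 mul1r => en; apply: (etrans en).
  rewrite zetaV -{2}[zeta]expg1 !eq_expg_mod_order zeta_order.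
  by rewrite /cyc rmorphB /= -!pmulrn; case: n n4 {en} => [|[|[|[|//]]]].
have off j : j <> k -> off_cycle nd (x j).
  move=> jk i; apply/eqP => e; apply: jk; apply: O_inj.
  have orbitP l : O l = orbit to [set: gT] (x l).
    have /imsetP[u _ Olu] : O l \in [set orbit to [set: gT] u | u : V].
      by rewrite -O_orbits; apply/imsetP; exists l.
    by have := x_repr l; rewrite Olu => /orbit_in_eqP ->.
  by rewrite !orbitP -e; apply/orbit_eqP; rewrite mem_orbit ?inE.
have unit4 : (4%:R : Zinv #|gT|) \is a GRing.unit.
  have card4 : #|gT| = 4%N by rewrite -cardsT zeta_gen -orderE.
  by apply: Zinv_natr_unit; rewrite card4.
have Q'_inv : quiver_invariant to Q' by exact: generalized_mutation_invariant.
have Q'E : Q' = _ := generalized_mutationE zeta to Q (x k).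
have nd0 : x k = nd 0 by rewrite /nd /node expg0 lact1.
split=> //; split=> i j.
  case: (i =P k) => [->|ik].
    have rowE := represents_incident_row zeta_gen zeta_order Q_inv (r0 j)
      (bE k j).
    case: (j =P k) rowE => [->|jk] rowE _;
      apply: (represents_inj (b'E k _) rowE) => g.
      (* On the diagonal both sides depend only on the 4-cycle, which leaves four coefficients to
         compute. *)
      have [n n4 ->] := zetaP zeta_gen zeta_order g.
      rewrite -![lact _ _ (x k)]/(nd n) -![node _ _ _ _]/(nd _) {1}nd0 !Q_cyc.
      rewrite Q'E exchange_cycle //.
      by case: n n4 => [|[|[|[|//]]]] _; vm_compute.
    rewrite {1}nd0 Q'E exchange_cycle_off //; exact: off_lact (off _ jk).
  case=> // ->.
  have colE := represents_incident_col zeta_order Q_inv (r0 k) (bE i k).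
  apply: (represents_inj (b'E i k) colE) => g.
  rewrite (exchange_lact_move _ _ _ Q'_inv) exchange_skew {1}nd0 Q'E.
  rewrite exchange_cycle_off ?opprK //.
  exact: off_lact (off _ ik).
move=> ik jk.
(* Left factors lie in column k, with scalar 1, so each product carries the scalar [r j] of the
   entry at (i, j). *)
have bik := bE i k; rewrite rk1 in bik.
have b'ik := b'E i k; rewrite rk1 in b'ik.
exact: (folded_off zeta_gen zeta_order Q_inv node_eq Q_cyc (r0 j) unit4
  (off _ ik) (off _ jk) bik (bE k j) (bE i j) b'ik (b'E k j) (b'E i j)).
Qed.
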